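(* Let $A$ be a triangular algebra over an algebraically closed field $k$, with $n$ pairwise non-isomorphic simple modules, Coxeter transformation $\phi_A$, Coxeter polynomial $\chi_A(T)$, and let $\lambda_1(A),\ldots,\lambda_n(A)$ be the roots of $\chi_A$ (with multiplicity). The following statements are equivalent: (1) $|\lambda_i(A)|\le 1$ for all $1\le i\le n$; (2) $|\lambda_i(A)|=1$ for all $1\le i\le n$; (3) $\rho_A=1$; (4) $M(\phi_A)=1$; (5) $e(\phi_A)=n$; (6) $\chi_A(T)$ factorizes as a product of cyclotomic polynomials.
   Context: Throughout $k$ is an algebraically closed field and a triangular algebra is a basic connected finite dimensional $k$-algebra whose quiver has no oriented cycles (hence it has finite global dimension). For such $A$, let $\mathrm{Der}(A)=D^b(\mathrm{mod}\,A)$ be the bounded derived category of finite dimensional left $A$-modules, with Auslander-Reiten translation the self-equivalence $\tau$ satisfying $D\mathrm{Hom}(X,Y[1])\cong \mathrm{Hom}(Y,\tau X)$ functorially. The Coxeter transformation $\phi_A$ is the automorphism of the Grothendieck group $K_0(A)=K_0(\mathrm{Der}(A))\cong\mathbb{Z}^n$ induced by $\tau$; equivalently $\phi_A[P_i]=-[I_i]$ where $P_i$, $I_i$ are the projective cover and injective envelope of the $i$-th simple module. The Coxeter polynomial $\chi_A(T)\in\mathbb{Z}[T]$ is the characteristic polynomial of $\phi_A$. The measures are: spectral radius $\rho_A=\max\{|\lambda|:\lambda\in\mathrm{Spec}(\phi_A)\}$; Mahler measure $M(\phi_A)=\prod_{i=1}^n\max\{1,|\lambda_i(A)|\}$; energy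 $e(\phi_A)=\sum_{i=1}^n|\lambda_i(A)|$. *)

(* Defs.v *)
From HB Require Import structures.
From mathcomp Require Import all_boot all_order all_algebra all_field.
From Stdlib Require Import Relation_Operators.
Set Implicit Arguments.
Unset Strict Implicit.
Unset Printing Implicit Defensive.
Import GRing.Theory.
Local Open Scope ring_scope.

Section Modules.
Context {k : fieldType} {A : falgType k}.

Record fdmod := FDMod {
  carrier :> vectType k;
  act : {linear A -> 'End(carrier)};
  act1 : act 1 = \1%VF;
  actM : forall a b : A, act (a * b) = (act a \o act b)%VF
}.

Definition is_hom (M N : fdmod) (f : 'Hom(M, N)) : Prop :=
  forall (a : A) (x : M), f (act M a x) = act N a (f x).

Definition isomorphic (M N : fdmod) : Prop :=
  exists f : 'Hom(M, N), [/\ is_hom f, lker f = 0%VS & limg f = fullv].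

Definition is_submod (M : fdmod) (U : {vspace M}) : Prop :=
  forall (a : A) (x : M), x \in U -> act M a x \in U.

Definition simple_mod (M : fdmod) : Prop :=
  (fullv : {vspace M}) <> 0%VS /\
  forall U : {vspace M}, is_submod U -> U = 0%VS \/ U = fullv.

Definition indecomposable_mod (M : fdmod) : Prop :=
  (fullv : {vspace M}) <> 0%VS /\
  forall U W : {vspace M}, is_submod U -> is_submod W ->
    (U :&: W = 0)%VS -> (U + W = fullv)%VS -> U = 0%VS \/ W = 0%VS.

Definition short_exact (L M N : fdmod) (f : 'Hom(L, M)) (g : 'Hom(M, N)) :
    Prop :=
  [/\ is_hom f, is_hom g, lker f = 0%VS, limg f = lker g & limg g = fullv].

Definition projective (P : fdmod) : Prop :=
  forall (M N : fdmod) (g : 'Hom(M, N)) (h : 'Hom(P, N)),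
    is_hom g -> limg g = fullv -> is_hom h ->
  exists2 h' : 'Hom(P, M), is_hom h' & (g \o h')%VF = h.

Definition injective_mod (I : fdmod) : Prop :=
  forall (M N : fdmod) (f : 'Hom(M, N)) (h : 'Hom(M, I)),
    is_hom f -> lker f = 0%VS -> is_hom h ->
  exists2 h' : 'Hom(N, I), is_hom h' & (h' \o f)%VF = h.

Definition projective_cover (P S : fdmod) : Prop :=
  projective P /\
  exists p : 'Hom(P, S),
    [/\ is_hom p, limg p = fullv &
      forall U : {vspace P}, is_submod U -> (U + lker p = fullv)%VS ->
        U = fullv].

Definition injective_envelope (I S : fdmod) : Prop :=
  injective_mod I /\
  exists j : 'Hom(S, I),
    [/\ is_hom j, lker j = 0%VS &
      forall U : {vspace I}, is_submod U -> (U :&: limg j = 0)%VS ->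
        U = 0%VS].

Section Submodule.
Variables (M : fdmod) (U : {vspace M}) (subU : is_submod U).

Definition sub_act_fun (a : A) (u : subvs_of U) : subvs_of U :=
  vsproj U (act M a (vsval u)).

Fact sub_act_fun_linear a : linear (sub_act_fun a).
Proof. by move=> c u v; rewrite /sub_act_fun !linearP. Qed.

HB.instance Definition _ a :=
  GRing.isLinear.Build k (subvs_of U) (subvs_of U) *:%R (sub_act_fun a)
    (sub_act_fun_linear a).

Definition sub_act (a : A) : 'End(subvs_of U) := linfun (sub_act_fun a).

Fact vsval_sub_act a u : vsval (sub_act a u) = act M a (vsval u).
Proof. by rewrite lfunE /= vsprojK // subU // subvsP. Qed.

Fact sub_act_linear : linear sub_act.
Proof.
move=> c a b; apply/lfunP => u; apply/val_inj; rewrite add_lfunE scale_lfunE.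
rewrite [LHS]vsval_sub_act [RHS](linearP vsval) [act M _]linearP.
by rewrite add_lfunE scale_lfunE /= !vsval_sub_act.
Qed.

HB.instance Definition _ :=
  GRing.isLinear.Build k A 'End(subvs_of U) *:%R sub_act sub_act_linear.

Fact sub_act1 : sub_act 1 = \1%VF.
Proof.
by apply/lfunP => u; apply: val_inj; rewrite /= vsval_sub_act act1 !lfunE.
Qed.

Fact sub_actM a b : sub_act (a * b) = (sub_act a \o sub_act b)%VF.
Proof.
apply/lfunP => u; apply: val_inj.
by rewrite /= vsval_sub_act actM !comp_lfunE /= !vsval_sub_act.
Qed.

Definition submod : fdmod := FDMod sub_act1 sub_actM.

End Submodule.

(* An arrow S -> T of the (Gabriel) quiver: Ext^1(S, T) <> 0 in Yoneda's sense,
   that is, some extension of S by T does not split.  The relation is invariant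
   under isomorphism, so that its oriented cycles are those of the quiver, whose
   vertices are the isomorphism classes of simple modules. *)
Definition quiver_arrow (S T : fdmod) : Prop :=
  [/\ simple_mod S, simple_mod T &
    exists (E : fdmod) (f : 'Hom(T, E)) (g : 'Hom(E, S)),
      short_exact f g /\
      ~ (exists2 s : 'Hom(S, E), is_hom s & (g \o s = \1)%VF)].

Definition simple_enumeration (n : nat) (S : 'I_n -> fdmod) : Prop :=
  [/\ forall i, simple_mod (S i),
      forall i j, isomorphic (S i) (S j) -> i = j &
      forall T, simple_mod T -> exists i, isomorphic T (S i)].

Definition additive_on_mod (G : zmodType) (f : fdmod -> G) : Prop :=
  forall (L M N : fdmod) (u : 'Hom(L, M)) (v : 'Hom(M, N)),
    short_exact u v -> f M = f L + f N.

(* cl identifies the Grothendieck group K_0(A) with Z^n: it is the universal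
   additive function on finite dimensional modules. *)
Definition grothendieck_class (n : nat) (cl : fdmod -> 'cV[int]_n) : Prop :=
  additive_on_mod cl /\
  forall (G : zmodType) (f : fdmod -> G), additive_on_mod f ->
  exists h : {additive 'cV[int]_n -> G},
    (forall M, h (cl M) = f M) /\
    forall h' : {additive 'cV[int]_n -> G},
      (forall M, h' (cl M) = f M) -> h' =1 h.

(* phi [P_i] = - [I_i] determines phi when A has finite global dimension, as
   the classes [P_i] then form a basis of K_0(A). *)
Definition coxeter_transformation (n : nat) (S : 'I_n -> fdmod)
    (cl : fdmod -> 'cV[int]_n) (phi : 'M[int]_n) : Prop :=
  exists P I : 'I_n -> fdmod,
    [/\ forall i, projective_cover (P i) (S i),
        forall i, injective_envelope (I i) (S i) &
        forall i, phi *m cl (P i) = - cl (I i)].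

End Modules.

Arguments fdmod {k} A.

Section Algebras.
Context {k : fieldType} (A : falgType k).

Definition regular_act (a : A) : 'End(A) := amull a.

Fact regular_act_linear : linear regular_act.
Proof. exact: linearP. Qed.

HB.instance Definition _ :=
  GRing.isLinear.Build k A 'End(A) *:%R regular_act regular_act_linear.

Fact regular_act1 : regular_act 1 = \1%VF.
Proof. exact: amull1. Qed.

Fact regular_actM a b :
  regular_act (a * b) = (regular_act a \o regular_act b)%VF.
Proof. by apply/lfunP => x; rewrite comp_lfunE !lfunE /= mulrA. Qed.

Definition regular_mod : fdmod A := FDMod regular_act1 regular_actM.

Definition basic_algebra : Prop :=
  exists (m : nat) (U : 'I_m -> {vspace regular_mod})
      (subU : forall i, is_submod (U i)),
    [/\ directv (\sum_i U i),
        (\sum_i U i = fullv)%VS,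
        forall i, indecomposable_mod (submod (subU i)) &
        forall i j, isomorphic (submod (subU i)) (submod (subU j)) -> i = j].

Definition connected_algebra : Prop :=
  forall e : A, e * e = e -> (forall a, e * a = a * e) -> e = 0 \/ e = 1.

Definition acyclic_quiver : Prop :=
  forall S : fdmod A, ~ clos_trans (fdmod A) quiver_arrow S S.

Definition triangular_algebra : Prop :=
  [/\ basic_algebra, connected_algebra & acyclic_quiver].

End Algebras.

Section Measures.
Variables (n : nat) (phi : 'M[int]_n).

Definition coxeter_poly : {poly int} := char_poly phi.

(* The complex roots of the characteristic polynomial, with multiplicity. *)
Definition eigenvalues : seq algC :=
  sval (closed_field_poly_normal (map_poly intr coxeter_poly : {poly algC})).

Definition spectral_radius : algC :=
  \big[Num.max/0]_(z <- eigenvalues) `|z|.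

Definition mahler_measure : algC :=
  \prod_(z <- eigenvalues) Num.max 1 `|z|.

Definition energy : algC := \sum_(z <- eigenvalues) `|z|.

End Measures.

Definition cyclotomic_product (p : {poly int}) : Prop :=
  exists2 s : seq nat, all (leq 1) s & p = \prod_(m <- s) 'Phi_m.

(* Main.v *)
Require Import Defs.
From HB Require Import structures.
From mathcomp Require Import all_boot all_order all_algebra all_field.
From Stdlib Require Import Classical Relation_Operators.
Set Implicit Arguments.
Unset Strict Implicit.
Unset Printing Implicit Defensive.
Import GRing.Theory.
Local Open Scope ring_scope.

(** Representation theory enters only through two facts: the integer matrix of
    the Coxeter transformation [phi] is nonsingular, and [n > 0].  The rest
    concerns a nonsingular integer matrix and its eigenvalues [z].

    Nonsingularity ([coxeter_det_neq0]).  If [u *m phi = 0] with [u] nonzero,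
    then [g M := u *m cl M] is additive on short exact sequences and vanishes
    on all the injective envelopes [I_i], because [phi [P_i] = - [I_i]].  The
    layers of a composition series of [I_i] above its socle [S_i] are simple
    modules with a path to [S_i] in the quiver ([essential_socle_path]).
    Since the quiver has no oriented cycle, a simple [S_i] outside the kernel
    of [g] can be chosen minimal for the path relation; then all the layers of
    [I_i] above [S_i] are killed, so [g S_i = g I_i = 0], a contradiction.
    Hence [g] vanishes on simples, thus on all modules, and uniqueness in the
    universal property of the Grothendieck group forces [u = 0].

    Eigenvalues.  The product of the [|z|] is [|det phi|], a nonzero natural
    number, hence at least 1.  So if all [|z|] are at most 1, they are all equal
    to 1 ([prod_norm_ge1_eq1]), and if their arithmetic mean is 1, equality holds
    in the inequality between arithmetic and geometric means and again they are
    all 1 ([sum_norm_eq_size]).  The remaining step is Kronecker's theorem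
    ([eigenvalue_unity_root]): the powers [z ^+ k] are roots of the
    characteristic polynomials of [phi ^+ k], which are integral of fixed
    degree with bounded coefficients, hence finitely many; so two powers of [z]
    coincide and [z] is a root of unity.  Dividing out minimal polynomials,
    which are cyclotomic, yields the factorization
    ([unity_roots_cyclotomic_product]). *)

(** * Minimal elements *)

Lemma exists_minimizer (T : Type) (P : T -> Prop) (m : T -> nat) (x0 : T) :
  P x0 -> exists2 x, P x & forall y, P y -> (m x <= m y)%N.
Proof.
have [d] := ubnP (m x0); elim: d x0 => // d IHd x0 /ltnSE le_x0 Px0.
have [[y [Py lt_y]] | no_y] := classic (exists y, P y /\ (m y < m x0)%N).
  exact: IHd (leq_trans lt_y le_x0) Py.
by exists x0 => // y Py; rewrite leqNgt; apply/negP => lt_y; case: no_y; exists y.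
Qed.

(** A minimal element of the tail of the list remains minimal unless the head
    lies below it, and then, by transitivity, the head is minimal. *)
Lemma finite_minimal (T : eqType) (R : T -> T -> Prop) (s : seq T) :
    (forall x y z, R x y -> R y z -> R x z) -> (forall x, ~ R x x) ->
  s != [::] -> exists2 x, x \in s & forall y, y \in s -> ~ R y x.
Proof.
move=> Rtr Rirr; elim: s => // x [|x1 s] IHs _.
  by exists x => [|y]; rewrite inE // => /eqP->.
have [// | y sy min_y] := IHs.
have [Rxy | nRxy] := classic (R x y).
  exists x => [|z]; first exact: mem_head.
  by rewrite inE => /predU1P[-> // | /min_y nRzy /Rtr/(_ Rxy)].
exists y => [|z]; first by rewrite inE sy orbT.
by rewrite inE => /predU1P[-> | /min_y].
Qed.

(** * Subquotients of a module *)

Lemma lfun_factor (k : fieldType) (M N P : vectType k) (U : {vspace M})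
    (q : 'Hom(M, N)) (r : 'Hom(M, P)) :
    (U :&: lker q <= lker r)%VS ->
  exists f : 'Hom(N, P), forall x, x \in U -> f (q x) = r x.
Proof.
move=> sub_ker; pose p := (q \o projv U)%VF.
exists (r \o projv U \o p^-1)%VF => x Ux; rewrite !comp_lfunE /=.
have qx : p (p^-1%VF (q x)) = q x.
  apply: limg_lfunVK; rewrite -[in q x](projv_id Ux) -comp_lfunE.
  by rewrite memv_img ?memvf.
set y := projv U _; have Uy : y \in U by exact: memv_proj.
apply/eqP; rewrite -subr_eq0 -linearB -memv_ker (subvP sub_ker) //.
by rewrite memv_cap rpredB //= memv_ker linearB /= -qx /p comp_lfunE subrr.
Qed.

Section Subquotients.
Context {k : fieldType} {A : falgType k}.
Implicit Types M N : fdmod A.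

(** The module [N] is a copy of [U / W], the projection being the restriction of
    [q] to [U].  Keeping [q] defined on the whole of [M] lets a chain of
    submodules be treated as subspaces of one fixed space; the values of [q]
    outside [U] are arbitrary. *)
Definition realizes M (U W : {vspace M}) N (q : 'Hom(M, N)) : Prop :=
  [/\ forall a x, x \in U -> q (act M a x) = act N a (q x),
      (q @: U = fullv)%VS & (U :&: lker q = W)%VS].

(** [W] is a maximal proper submodule of [U], that is, [U / W] is simple. *)
Definition covered M (W U : {vspace M}) : Prop :=
  [/\ (W <= U)%VS, W <> U &
      forall X, is_submod X -> (W <= X)%VS -> (X <= U)%VS -> X = W \/ X = U].

Lemma is_submod0 M : is_submod (0%VS : {vspace M}).
Proof. by move=> a x; rewrite !memv0 => /eqP->; rewrite linear0. Qed.

Lemma is_submod_full M : is_submod (fullv : {vspace M}).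
Proof. by move=> a x _; rewrite memvf. Qed.

Lemma is_submod_cap M (U W : {vspace M}) :
  is_submod U -> is_submod W -> is_submod (U :&: W)%VS.
Proof.
by move=> sU sW a x; rewrite !memv_cap => /andP[/sU-> /sW->].
Qed.

Lemma is_submod_limg M N (f : 'Hom(M, N)) : is_hom f -> is_submod (limg f).
Proof.
by move=> f_hom a x /memv_imgP[y _ ->]; rewrite -f_hom memv_img ?memvf.
Qed.

Lemma realizes_mono_inv M N (j : 'Hom(N, M)) :
  is_hom j -> lker j = 0%VS -> realizes (limg j) 0%VS j^-1%VF.
Proof.
move=> j_hom /eqP j_ker; split=> [a x /memv_imgP[y _ ->]||].
- by rewrite -j_hom !lker0_lfunK.
- apply/eqP; rewrite eqEsubv subvf; apply/subvP=> y _.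
  by rewrite -[y](lker0_lfunK j_ker) memv_img ?memv_img ?memvf.
apply/eqP; rewrite -subv0; apply/subvP=> x; rewrite memv_cap memv_ker memv0.
by case/andP=> /memv_imgP[y _ ->]; rewrite lker0_lfunK // => /eqP->; rewrite linear0.
Qed.

Lemma realizes_onto M (U W : {vspace M}) N (q : 'Hom(M, N)) :
  realizes U W q -> forall y, exists2 x, x \in U & q x = y.
Proof.
case=> _ qU _ y; have: y \in (q @: U)%VS by rewrite qU memvf.
by case/memv_imgP=> x Ux ->; exists x.
Qed.

Lemma realizes_eq0 M (U W : {vspace M}) N (q : 'Hom(M, N)) x :
  realizes U W q -> x \in U -> (q x == 0) = (x \in W).
Proof. by case=> _ _ <- Ux; rewrite memv_cap Ux memv_ker. Qed.

Lemma realizes_sub M (U W : {vspace M}) N (q : 'Hom(M, N)) :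
  realizes U W q -> (W <= U)%VS.
Proof. by case=> _ _ <-; apply: capvSl. Qed.

(** The quotient lives on a linear complement [C] of [W] in [U], on which [a]
    acts by [act M a] followed by the projection to [C] along [W]. *)
Lemma exists_realizes M (U W : {vspace M}) :
    is_submod U -> is_submod W -> (W <= U)%VS ->
  exists N (q : 'Hom(M, N)), realizes U W q.
Proof.
move=> sU sW WU; pose C := (U :\: W)%VS.
have CW0 : (C :&: W = 0)%VS by rewrite capv_diff.
have CWU : (C + W = U)%VS.
  by rewrite -[RHS](addv_diff_cap U W) (capv_idPr WU).
have CU : (C <= U)%VS by exact: diffvSl.
pose q : 'Hom(M, subvs_of C) := linfun (vsproj C \o daddv_pi C W).
pose s : 'Hom(subvs_of C, M) := linfun vsval.
have qE x : q x = vsproj C (daddv_pi C W x) by rewrite lfunE.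
have sE v : s v = vsval v by rewrite lfunE.
have sU' v : s v \in U by rewrite sE (subvP CU) ?subvsP.
have sq x : s (q x) = daddv_pi C W x by rewrite sE qE vsprojK ?memv_pi.
have qs v : q (s v) = v.
  by apply: val_inj; rewrite /= -sE sq sE daddv_pi_id ?subvsP.
have qW x : x \in W -> q x = 0.
  move=> Wx; rewrite qE; suff ->: daddv_pi C W x = 0 by rewrite linear0.
  apply: (addIr x); rewrite add0r -[RHS](@daddv_pi_add _ _ C W x CW0).
    by rewrite (daddv_pi_id _ Wx) // capvC.
  by rewrite CWU (subvP WU).
have qr x : x \in U -> x - s (q x) \in W.
  move=> Ux; rewrite sq -{1}[x](@daddv_pi_add _ _ C W x CW0) ?CWU //.
  by rewrite addrC addKr memv_pi.
have actq a x : x \in U -> q (act M a x) = q (act M a (s (q x))).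
  move=> Ux; apply/eqP; rewrite -subr_eq0 -!linearB /=; apply/eqP/qW.
  exact/sW/qr.
pose f a : 'End(subvs_of C) := (q \o act M a \o s)%VF.
have fE a v : f a v = q (act M a (s v)) by rewrite !comp_lfunE.
have flin : linear f.
  move=> c a b; apply/lfunP=> v.
  by rewrite add_lfunE scale_lfunE !fE linearP add_lfunE scale_lfunE linearP.
pose F : {linear A -> 'End(subvs_of C)} :=
  HB.pack f (GRing.isLinear.Build k A 'End(subvs_of C) *:%R f flin).
have F1 : F 1 = \1%VF by apply/lfunP=> v; rewrite [LHS]fE act1 !id_lfunE qs.
have FM a b : F (a * b) = (F a \o F b)%VF.
  apply/lfunP=> v; rewrite comp_lfunE [LHS]fE [RHS]fE [F b v]fE.
  by rewrite actM comp_lfunE actq //; apply: sU.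
exists (FDMod F1 FM), q; split=> [a x Ux||].
- by rewrite [RHS]fE; apply: actq.
- apply/eqP; rewrite eqEsubv subvf /=.
  by apply/subvP=> v _; rewrite -[v]qs memv_img.
- apply/eqP; rewrite eqEsubv; apply/andP; split; apply/subvP=> x.
    rewrite memv_cap memv_ker => /andP[Ux /eqP qx].
    by rewrite -[x]subr0 -(linear0 s) -qx qr.
  by move=> Wx; rewrite memv_cap memv_ker qW // eqxx (subvP WU).
Qed.

(** The sequence [V / W -> U / W -> U / V].  The maps are returned together with
    their compatibility with the projections, which the construction of
    nonsplit extensions relies on. *)
Lemma realizes_short_exact M (U V W : {vspace M}) N1 N2 N3
    (q1 : 'Hom(M, N1)) (q2 : 'Hom(M, N2)) (q3 : 'Hom(M, N3)) :
    is_submod U -> is_submod V ->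
    realizes V W q1 -> realizes U W q2 -> realizes U V q3 ->
  exists (f : 'Hom(N1, N2)) (g : 'Hom(N2, N3)),
    [/\ short_exact f g, forall x, x \in V -> f (q1 x) = q2 x &
        forall x, x \in U -> g (q2 x) = q3 x].
Proof.
move=> sU sV r1 r2 r3.
have [VU WV] := (realizes_sub r3, realizes_sub r1).
have [f fE] : exists f : 'Hom(N1, N2), forall x, x \in V -> f (q1 x) = q2 x.
  apply: lfun_factor; case: r1 => _ _ ->; case: r2 => _ _ <-; exact: capvSr.
have [g gE] : exists g : 'Hom(N2, N3), forall x, x \in U -> g (q2 x) = q3 x.
  apply: lfun_factor; case: r2 => _ _ ->; apply: subv_trans WV _.
  by case: r3 => _ _ <-; exact: capvSr.
exists f, g; split=> //; split.
- move=> a y; have [x Vx <-] := realizes_onto r1 y.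
  have [[e1 _ _] [e2 _ _]] := (r1, r2).
  by rewrite -e1 // !fE ?e2 ?(subvP VU) //; apply: sV.
- move=> a y; have [x Ux <-] := realizes_onto r2 y.
  have [[e2 _ _] [e3 _ _]] := (r2, r3).
  by rewrite -e2 // !gE ?e3 //; apply: sU.
- apply/eqP; rewrite -subv0; apply/subvP=> y.
  have [x Vx <-] := realizes_onto r1 y.
  by rewrite memv_ker fE // memv0 (realizes_eq0 r1) // (realizes_eq0 r2) ?(subvP VU).
- apply/eqP; rewrite eqEsubv; apply/andP; split; apply/subvP=> y.
    case/memv_imgP=> z _ ->; have [x Vx <-] := realizes_onto r1 z.
    by rewrite memv_ker fE ?gE ?(realizes_eq0 r3) ?(subvP VU).
  have [x Ux <-] := realizes_onto r2 y.
  rewrite memv_ker gE ?(realizes_eq0 r3) // => Vx.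
  by rewrite -fE ?memv_img ?memvf.
- apply/eqP; rewrite eqEsubv subvf; apply/subvP=> y _.
  have [x Ux <-] := realizes_onto r3 y.
  by rewrite -gE ?memv_img ?memvf.
Qed.

Lemma exists_covered M (S L : {vspace M}) :
    is_submod S -> (S <= L)%VS -> S <> L ->
  exists L', [/\ is_submod L', (S <= L')%VS & covered L' L].
Proof.
move=> sS SL neSL.
pose P X := [/\ is_submod X, (S <= X)%VS, (X <= L)%VS & X <> L].
have [//|X [sX SX XL neX] maxX] :=
  @exists_minimizer _ P (fun X => \dim L - \dim X)%N S.
exists X; split=> //; split=> // Y sY XY YL.
have [-> | neY] := eqVneq Y L; [by right | left].
apply/eqP; rewrite eq_sym eqEdim XY /=.
have PY: P Y by split=> //; [apply: subv_trans XY | apply/eqP].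
by have := maxX Y PY; rewrite leq_sub2lE // dimvS.
Qed.

Lemma realizes_simple M (L' L : {vspace M}) N (q : 'Hom(M, N)) :
  is_submod L -> covered L' L -> realizes L L' q -> simple_mod N.
Proof.
move=> sL [L'L neL cov] rq; have [qa qL qk] := rq; split=> [N0|X sX].
  apply: neL; apply/eqP; rewrite eqEsubv L'L; apply/subvP=> x Lx.
  by rewrite -(realizes_eq0 rq) // -memv0 -N0 memvf.
pose Y := (L :&: q @^-1: X)%VS.
have YE x : (x \in Y) = (x \in L) && (q x \in X) by rewrite memv_cap memv_preim.
have [|||YL'|YL] := cov Y.
- by move=> a x; rewrite !YE => /andP[Lx Xx]; rewrite sL // qa // sX.
- apply/subvP=> x L'x; rewrite YE (subvP L'L) //=.
  have /eqP-> : q x == 0 by rewrite (realizes_eq0 rq) // (subvP L'L).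
  exact: mem0v.
- exact: capvSl.
- left; apply/eqP; rewrite -subv0; apply/subvP=> y.
  have [x Lx <-] := realizes_onto rq y; move=> Xq.
  by rewrite memv0 (realizes_eq0 rq) // -YL' YE Lx.
- right; apply/eqP; rewrite eqEsubv subvf; apply/subvP=> y _.
  by have [x Lx <-] := realizes_onto rq y; move: Lx; rewrite -YL YE => /andP[].
Qed.

(** * Paths in the quiver *)

(** When [V] has [L] as its unique maximal submodule, [V / L'] is an extension of
    [V / L] by [L / L'] with the same property.  A section would give a second
    submodule supplementing [L / L'], so the extension does not split. *)
Lemma superfluous_arrow M (V L L' : {vspace M}) N (F : fdmod A)
    (q : 'Hom(M, N)) (r : 'Hom(M, F)) :
    is_submod V -> is_submod L -> is_submod L' -> L' <> L ->
    (forall X, is_submod X -> (X <= V)%VS -> X <> V -> (X <= L)%VS) ->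
    simple_mod N -> simple_mod F -> realizes V L q -> realizes L L' r ->
  quiver_arrow N F.
Proof.
move=> sV sL sL' neL topV simN simF rq rr.
have [LV L'L] := (realizes_sub rq, realizes_sub rr).
have [E [p rp]] := exists_realizes sV sL' (subv_trans L'L LV).
have [f [g [ses fE gE]]] := realizes_short_exact sV sL rr rp rq.
split=> //; exists E, f, g; split=> // -[s s_hom sK].
have gs n : g (s n) = n by rewrite -comp_lfunE sK id_lfunE.
(* The preimage in [V] of the image of the section [s]. *)
pose X := (V :&: p @^-1: limg s)%VS.
have XE x : (x \in X) = (x \in V) && (p x \in limg s).
  by rewrite memv_cap memv_preim.
have pa : forall a x, x \in V -> p (act M a x) = act E a (p x) by case: rp.
have sX : is_submod X.
  move=> a x; rewrite !XE => /andP[Vx /memv_imgP[n _ pxE]].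
  by rewrite sV // pa // pxE -s_hom memv_img ?memvf.
have XV : (X <= V)%VS by exact: capvSl.
have [defX | /eqP neX] := eqVneq X V.
  case: neL; apply/eqP; rewrite eqEsubv L'L; apply/subvP=> x Lx.
  have Vx := subvP LV x Lx; have:= Vx.
  rewrite -{1}defX XE => /andP[_ /memv_imgP[n _ pxE]].
  have /eqP n0 : n == 0.
    by rewrite -[n]gs -pxE gE // (realizes_eq0 rq).
  by rewrite -(realizes_eq0 rp) // pxE n0 linear0.
have XL := topV X sX XV neX; case: simN => N0 _; apply: N0.
apply/eqP; rewrite -subv0; apply/subvP=> n _.
have [x Vx pxE] := realizes_onto rp (s n).
rewrite memv0 -[n]gs -pxE gE // (realizes_eq0 rq) // (subvP XL) //.
by rewrite XE Vx pxE memv_img ?memvf.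
Qed.

(** Let [K / K'] be a simple layer above the essential simple submodule
    [J = limg j].  A submodule [V] of minimal dimension among those contained in
    [K] but not in [K'] has [L = V :&: K'] as its unique maximal submodule, and
    [V / L] is isomorphic to [K / K'].  As [J] is essential, it lies in [L].  If
    [L = J], then [V] itself is a nonsplit extension of [K / K'] by [S];
    otherwise a maximal submodule [L'] of [L] above [J] yields an arrow from
    [K / K'] to the layer [L / L'], which is treated by induction on the
    dimension, since [L] is smaller than [K]. *)
Lemma essential_socle_path M (S : fdmod A) (j : 'Hom(S, M)) :
    simple_mod S -> is_hom j -> lker j = 0%VS ->
    (forall U : {vspace M}, is_submod U -> U <> 0%VS -> (limg j <= U)%VS) ->
  forall (K' K : {vspace M}) N (q : 'Hom(M, N)),
    is_submod K' -> is_submod K -> (limg j <= K')%VS -> covered K' K ->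
    realizes K K' q -> clos_trans (fdmod A) quiver_arrow N S.
Proof.
move=> simS j_hom j_ker j_ess K' K.
have [d] := ubnP (\dim K); elim: d K' K => // d IHd K' K /ltnSE dimK N q.
move=> sK' sK SK' cov rq; have [K'K neK _] := cov.
have simN := realizes_simple sK cov rq.
pose J := limg j; have sJ : is_submod J by exact: is_submod_limg.
have rJ := realizes_mono_inv j_hom j_ker; rewrite -/J in rJ.
pose P X := [/\ is_submod X, (X <= K)%VS & ~~ (X <= K')%VS].
have [|V [sV VK nVK'] minV] := @exists_minimizer _ P (fun X => \dim X) K.
  split=> //; apply/negP=> KK'; apply: neK; apply/eqP.
  by rewrite eqEsubv K'K.
pose L := (V :&: K')%VS; have sL : is_submod L by exact: is_submod_cap.
(* By minimality of [V], every proper submodule of [V] lies in [K']. *)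
have topV X : is_submod X -> (X <= V)%VS -> X <> V -> (X <= L)%VS.
  move=> sX XV neX; rewrite subv_cap XV /=; apply/negPn/negP=> nXK'.
  apply: neX; apply/eqP; rewrite eqEdim XV minV //.
  by split=> //; apply: subv_trans VK.
(* By the second isomorphism theorem the projection of [K / K'] also serves for
   [V / L], so that no isomorphism has to be carried along the path. *)
have rV : realizes V L q.
  have [qa _ qk] := rq; split=> [a x Vx||]; first by rewrite qa ?(subvP VK).
    have [_ /(_ (q @: V)%VS)[]] := simN => //.
      move=> a y /memv_imgP[x Vx ->]; rewrite -qa ?(subvP VK) //.
      by rewrite memv_img ?sV.
    move/eqP; rewrite -lkerE => Vq; case/negP: nVK'.
    by rewrite -qk subv_cap VK.
  by rewrite /L -qk capvA (capv_idPl VK).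
have JL : (J <= L)%VS.
  rewrite subv_cap SK' andbT j_ess // => V0.
  by case/negP: nVK'; rewrite V0 sub0v.
have [defL | /eqP neL] := eqVneq J L.
  apply: t_step; rewrite defL in rJ.
  apply: (superfluous_arrow sV sL (@is_submod0 M) _ topV simN simS rV rJ) => L0.
  case: simS => S0 _; apply: S0; apply/eqP; rewrite -subv0 -j_ker.
  by rewrite lkerE -/J defL -L0.
have [L' [sL' JL' covL]] := exists_covered sJ JL neL.
have [L'L neL' _] := covL.
have [F [r rr]] := exists_realizes sL sL' L'L.
have simF := realizes_simple sL covL rr.
apply: (@t_trans _ _ N F).
  exact/t_step/(superfluous_arrow sV sL sL' neL' topV simN simF rV rr).
apply: (IHd _ _ _ _ _ sL' sL JL' covL rr); apply: leq_trans dimK.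
have LK' : (L <= K')%VS by exact: capvSr.
apply: leq_ltn_trans (dimvS LK') _.
by rewrite (ltn_leqif (dimv_leqif_sup K'K)); apply/negP=> KK'; apply/neK/eqP; rewrite eqEsubv K'K.
Qed.

(** * Additive functions and the Grothendieck group *)

Section Additive.
Variables (G : zmodType) (g : fdmod A -> G).
Hypothesis g_add : additive_on_mod g.

Lemma additive_realizes M (U V W : {vspace M}) N1 N2 N3
    (q1 : 'Hom(M, N1)) (q2 : 'Hom(M, N2)) (q3 : 'Hom(M, N3)) :
    is_submod U -> is_submod V ->
    realizes V W q1 -> realizes U W q2 -> realizes U V q3 ->
  g N2 = g N1 + g N3.
Proof.
move=> sU sV r1 r2 r3.
by have [u [v [/g_add]]] := realizes_short_exact sU sV r1 r2 r3.
Qed.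

(** The zero module satisfies [0 -> Z -> Z -> Z -> 0]. *)
Lemma additive_zero M (U : {vspace M}) N (q : 'Hom(M, N)) :
  is_submod U -> realizes U U q -> g N = 0.
Proof.
move=> sU rq; have /eqP := additive_realizes sU sU rq rq rq.
by rewrite -subr_eq0 opprD addNKr oppr_eq0 => /eqP.
Qed.

Lemma additive_realizes_eq M (U W : {vspace M}) N1 N2
    (q1 : 'Hom(M, N1)) (q2 : 'Hom(M, N2)) :
  is_submod U -> realizes U W q1 -> realizes U W q2 -> g N1 = g N2.
Proof.
move=> sU r1 r2; have [N3 [q3 r3]] := exists_realizes sU sU (subvv U).
by rewrite (additive_realizes sU sU r1 r2 r3) (additive_zero sU r3) addr0.
Qed.

(** Additivity along a filtration of [M] that starts at [J] and has simple
    layers.  It serves twice: with [J] the socle of an injective envelope, and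
    with [J = 0]. *)
Lemma additive_filtration M (J : {vspace M}) (NJ : fdmod A) (qJ : 'Hom(M, NJ)) :
    is_submod J -> realizes J 0%VS qJ ->
    (forall K' K, is_submod K' -> is_submod K -> (J <= K')%VS -> covered K' K ->
     exists N (q : 'Hom(M, N)), realizes K K' q /\ g N = 0) ->
  g M = g NJ.
Proof.
move=> sJ rJ g_layer.
have r_id : realizes (fullv : {vspace M}) 0%VS \1%VF.
  split=> [a x _||]; first by rewrite !id_lfunE.
    by rewrite lim1g.
  apply/eqP; rewrite -subv0; apply/subvP=> x.
  by rewrite memv_cap memv_ker id_lfunE memv0 => /andP[].
suff gK (K : {vspace M}) N (q : 'Hom(M, N)) : is_submod K -> (J <= K)%VS ->
    realizes K 0%VS q -> g N = g NJ.
  exact: gK (@is_submod_full M) (subvf J) r_id.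
have [d] := ubnP (\dim K); elim: d K N q => // d IHd K N q /ltnSE dimK sK JK rq.
have [eqJK | /eqP neJK] := eqVneq J K.
  by rewrite -eqJK in rq sK; apply: additive_realizes_eq rq rJ.
have [K' [sK' JK' cov]] := exists_covered sJ JK neJK.
have [K'K neK _] := cov.
have [N' [q' rq']] := exists_realizes sK' (@is_submod0 M) (sub0v K').
have [N'' [q'' [rq'' gN'']]] := g_layer _ _ sK' sK JK' cov.
rewrite (additive_realizes sK sK' rq' rq rq'') gN'' addr0.
apply: IHd sK' JK' rq'; apply: leq_trans dimK.
by rewrite (ltn_leqif (dimv_leqif_eq K'K)); apply/eqP.
Qed.

End Additive.

Section Enumeration.
Variables (n : nat) (S : 'I_n -> fdmod A).
Hypothesis S_simples : simple_enumeration S.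

(** A layer is realized by a member of the enumeration itself rather than by an
    isomorphic module, because paths in the quiver are between modules, not
    isomorphism classes. *)
Lemma covered_realized_simple M (K' K : {vspace M}) :
    is_submod K' -> is_submod K -> covered K' K ->
  exists i (q : 'Hom(M, S i)), realizes K K' q.
Proof.
move=> sK' sK cov; have [K'K _ _] := cov.
have [N [q rq]] := exists_realizes sK sK' K'K.
have [_ _ /(_ N (realizes_simple sK cov rq))[i [f [f_hom /eqP/lker0P f_inj f_im]]]] := S_simples.
have [qa qK qk] := rq; exists i, (f \o q)%VF; split=> [a x Kx||].
- by rewrite !comp_lfunE qa.
- by rewrite limg_comp qK.
rewrite -qk; apply/vspaceP=> x; rewrite !memv_cap !memv_ker comp_lfunE.
by rewrite -(linear0 f) (inj_eq f_inj).
Qed.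

(** The quotient of [A] by a maximal left ideal is simple. *)
Lemma simple_enumeration_nonempty : (0 < n)%N.
Proof.
have neA0 : (fullv : {vspace regular_mod A}) <> 0%VS.
  move=> A0; have: (1 : A) \in (fullv : {vspace regular_mod A}) by exact: memvf.
  by rewrite A0 memv0 oner_eq0.
have [//|L [sL _ cov]] := exists_covered (@is_submod0 (regular_mod A)) (subvf _).
  by move/esym.
have [i _] := covered_realized_simple sL (@is_submod_full _) cov.
exact: leq_ltn_trans (leq0n i) (ltn_ord i).
Qed.

Variables (G : zmodType) (g : fdmod A -> G).
Hypothesis g_add : additive_on_mod g.

Lemma additive_eq0_on_simples : (forall i, g (S i) = 0) -> forall M, g M = 0.
Proof.
move=> gS M; have s0 := @is_submod0 M.
have [Z [q rq]] := exists_realizes s0 s0 (subvv _).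
rewrite -(additive_zero g_add s0 rq); apply: (additive_filtration g_add s0 rq).
move=> K' K sK' sK _ /(covered_realized_simple sK' sK)[i [r rr]].
by exists (S i), r.
Qed.

(** The layers of the envelope above its socle [S i] all have a path to [S i]. *)
Lemma additive_envelope M i :
    (forall j, clos_trans (fdmod A) quiver_arrow (S j) (S i) -> g (S j) = 0) ->
    injective_envelope M (S i) ->
  g M = g (S i).
Proof.
move=> g_pred [_ [j [j_hom j_ker j_ess]]].
have [S_simple _ _] := S_simples; have [_ simSi] := S_simple i.
have rJ := realizes_mono_inv j_hom j_ker.
apply: (additive_filtration g_add (is_submod_limg j_hom) rJ).
move=> K' K sK' sK JK' cov.
have [l [q rq]] := covered_realized_simple sK' sK cov.
exists (S l), q; split=> //; apply: g_pred.
apply: (essential_socle_path (S_simple i) j_hom j_ker _ sK' sK JK' cov rq).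
move=> U sU U_neq0; pose X := (j @^-1: U)%VS.
have XE y : (y \in X) = (j y \in U) by rewrite -memv_preim.
have [a x|X0|Xfull] := simSi X.
- by rewrite !XE j_hom; apply: sU.
- case: U_neq0; apply: j_ess => //; apply/eqP; rewrite -subv0.
  apply/subvP=> x; rewrite memv_cap => /andP[Ux /memv_imgP[y _ xE]].
  have: y \in X by rewrite XE -xE.
  by rewrite X0 memv0 xE => /eqP->; rewrite linear0 mem0v.
- by apply/subvP=> x /memv_imgP[y _ ->]; rewrite -XE Xfull memvf.
Qed.

(** Otherwise pick a simple [S i] with [g (S i)] nonzero that is minimal for the
    path relation, which is a strict order by acyclicity.  Everything strictly
    below it is killed, so [g (S i) = g (I i) = 0]. *)
Lemma additive_eq0_on_envelopes (I : 'I_n -> fdmod A) :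
    acyclic_quiver A -> (forall i, injective_envelope (I i) (S i)) ->
  (forall i, g (I i) = 0) -> forall M, g M = 0.
Proof.
move=> acyclic envI gI; apply: additive_eq0_on_simples => i0.
pose R i j := clos_trans (fdmod A) quiver_arrow (S i) (S j).
pose s := [seq i <- enum 'I_n | g (S i) != 0].
apply/eqP/negPn/negP=> gSi0.
have s_neq0 : s != [::].
  by apply/eqP=> s0; have: i0 \in s by [rewrite mem_filter gSi0 mem_enum]; rewrite s0.
have [x y z Rxy Ryz|x|i] := finite_minimal (R := R) _ _ s_neq0.
- exact: t_trans Rxy Ryz.
- exact: acyclic.
rewrite mem_filter => /andP[/eqP gSi _] min_i; apply: gSi.
rewrite -(additive_envelope _ (envI i)) ?gI // => j Rji.
apply/eqP/negPn/negP=> gSj; apply: min_i Rji.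
by rewrite mem_filter gSj mem_enum.
Qed.

End Enumeration.
End Subquotients.

(** A row vector in the kernel of [phi] would define an additive function that
    vanishes on injective envelopes, hence everywhere; the universal property
    then identifies the vector with 0. *)
Lemma coxeter_det_neq0 (k : fieldType) (A : falgType k) (n : nat)
    (S : 'I_n -> fdmod A) (cl : fdmod A -> 'cV[int]_n) (phi : 'M[int]_n) :
    acyclic_quiver A -> simple_enumeration S -> grothendieck_class cl ->
    coxeter_transformation S cl phi ->
  \det phi != 0.
Proof.
move=> acyclic S_simples [cl_add cl_univ] [P [I [_ envI phiP]]].
apply/det0P=> -[u u_neq0 u_phi].
pose g M := u *m cl M.
have g_add : additive_on_mod g.
  by move=> L M N v w /cl_add clM; rewrite /g clM mulmxDr.
have gI i : g (I i) = 0.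
  by rewrite /g -[cl _]opprK -phiP mulmxN mulmxA u_phi mul0mx oppr0.
have g0 := additive_eq0_on_envelopes S_simples g_add acyclic envI gI.
have [h [_ h_uniq]] := cl_univ _ g g_add.
have hu : mulmx u =1 h by apply: (h_uniq (mulmx u)).
have h0 : mulmx 0 =1 h by apply: (h_uniq (mulmx 0)) => M; rewrite g0; apply: mul0mx.
case/eqP: u_neq0; apply/rowP=> j; rewrite mxE.
have := etrans (hu (delta_mx j 0)) (esym (h0 _)).
by rewrite mul0mx -colE => /colP/(_ 0); rewrite !mxE.
Qed.

Import Order.TTheory Num.Theory.

(** * Characteristic polynomials of powers *)

Lemma char_poly_conj (F : fieldType) n (P A : 'M[F]_n) :
  P \in unitmx -> char_poly (P *m A *m invmx P) = char_poly A.
Proof.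
move=> uP; pose c := map_mx (@polyC F).
have cP1 : c _ _ P *m c _ _ (invmx P) = 1%:M by rewrite -map_mxM mulmxV ?map_mx1.
have cPdet : \det (c _ _ P) * \det (c _ _ (invmx P)) = 1.
  by rewrite -det_mulmx cP1 det1.
rewrite /char_poly.
have ->: char_poly_mx (P *m A *m invmx P)
         = c _ _ P *m char_poly_mx A *m c _ _ (invmx P).
  rewrite /char_poly_mx !map_mxM mulmxBr mulmxBl; congr (_ - _).
  by rewrite mul_mx_scalar -scalemxAl cP1 scalemx1.
by rewrite !det_mulmx mulrAC cPdet mul1r.
Qed.

Lemma is_trig_mx_exp (R : comNzRingType) n (T : 'M[R]_n) k :
  is_trig_mx T -> is_trig_mx (T ^+ k) /\ forall i, (T ^+ k) i i = T i i ^+ k.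
Proof.
move=> /is_trig_mxP trigT; elim: k => [|k [/is_trig_mxP trigTk diagTk]].
  by rewrite expr0 scalar_mx_is_trig; split=> // i; rewrite mxE eqxx.
rewrite exprS; split=> [|i].
  apply/is_trig_mxP=> i j lt_ij; rewrite mxE big1 // => l _.
  have [lt_il | le_li] := ltnP i l; first by rewrite trigT ?mul0r.
  by rewrite trigTk ?mulr0 // (leq_ltn_trans le_li).
rewrite mxE (bigD1 i) //= diagTk exprS big1 ?addr0 // => l.
rewrite -val_eqE neq_ltn => /orP[lt_li | lt_il]; last by rewrite trigT ?mul0r.
by rewrite trigTk ?mulr0.
Qed.

(** After a unitary change of basis the matrix is triangular, and the diagonal
    of a power of a triangular matrix consists of the powers of its diagonal. *)
Lemma char_poly_exp (C : numClosedFieldType) n (A : 'M[C]_n) :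
  exists t : 'I_n -> C,
    forall k, char_poly (A ^+ k) = \prod_i ('X - (t i ^+ k)%:P).
Proof.
have [|P /unitarymx_unit uP /=] := @cotrigonalization _ _ [:: A].
  by move=> B B'; rewrite !inE => /eqP-> /eqP->.
rewrite andbT /similar_to conjumx //; set T := _ *m _ => trigT.
exists (fun i => T i i) => k.
have [trigTk diagTk] := is_trig_mx_exp k trigT.
rewrite -(char_poly_conj _ uP).
have ->: P *m (A ^+ k) *m invmx P = T ^+ k.
  elim: k {trigTk diagTk} => [|k IHk]; first by rewrite !expr0 mulmx1 mulmxV.
  rewrite !exprS -IHk -[A * _]/(A *m _) -[T * _]/(T *m _) /T.
  by rewrite !mulmxA mulmxKV.
by rewrite char_poly_trig //; apply: eq_bigr => i _; rewrite diagTk.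
Qed.

(** * Kronecker's theorem *)

(** Multiplication by [X - a] with [a] in the unit disc at most doubles a bound
    on the coefficients. *)
Lemma coef_prod_XsubC_bound (R : numDomainType) (s : seq R) j :
    (forall z, z \in s -> `|z| <= 1) ->
  `|(\prod_(z <- s) ('X - z%:P))`_j| <= (2 ^ size s)%:R.
Proof.
elim: s j => [|a s IHs] j le1.
  by rewrite big_nil coef1; case: eqP => _; rewrite ?normr1 ?normr0.
have IH i := IHs i (fun z sz => le1 z (mem_behead (sz : z \in behead (a :: s)))).
rewrite big_cons mulrBl coefB coefCM coefXM expnS mul2n -addnn natrD.
apply: le_trans (ler_normB _ _) (lerD _ _).
  by case: eqP => _; rewrite ?normr0 ?ler0n.
rewrite normrM -[leRHS]mul1r ler_pM ?normr_ge0 ?le1 ?mem_head //.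
Qed.

(** There are finitely many integer polynomials of bounded degree and
    coefficients, hence finitely many roots of such polynomials. *)
Lemma bounded_int_poly_roots (n B : nat) :
  exists R : seq algC, forall p : {poly int},
    p != 0 -> (size p <= n)%N -> (forall j, `|p`_j| <= B%:Z) ->
  forall z, root (map_poly intr p : {poly algC}) z -> z \in R.
Proof.
(* Coefficients between [- B] and [B] are shifted by [B] into an ordinal. *)
pose P (f : {ffun 'I_n -> 'I_(B + B).+1}) : {poly int} :=
  \sum_(j < n) ((f j)%:Z - B%:Z)%:P * 'X^j.
pose rts (q : {poly algC}) := sval (closed_field_poly_normal q).
exists (flatten [seq rts (map_poly intr (P f)) | f : {ffun 'I_n -> 'I_(B + B).+1}]).
move=> p p_neq0 size_p le_pB z z_root.
have pE j : p`_j = (inord (absz (p`_j + B%:Z)) : 'I_(B + B).+1)%:Z - B%:Z.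
  have := le_pB j; rewrite ler_norml => /andP[ge_p le_p].
  have ge0 : 0 <= p`_j + B%:Z by rewrite -lerBlDr sub0r.
  rewrite inordK ?gez0_abs ?addrK // ltnS -lez_nat gez0_abs //.
  by rewrite PoszD lerD2r.
apply/flattenP; exists (rts (map_poly intr p)); last first.
  rewrite /rts; case: closed_field_poly_normal => r /= pr.
  move: z_root; rewrite pr rootZ ?root_prod_XsubC //.
  rewrite lead_coef_map_inj //; last exact: intr_inj.
  by rewrite intr_eq0 lead_coef_eq0.
apply/imageP; exists [ffun j : 'I_n => inord (absz (p`_j + B%:Z))] => //.
congr (rts (map_poly _ _)); rewrite /P -[LHS]coefK.
rewrite poly_def (big_ord_widen _ (fun j => p`_j *: 'X^j) size_p) big_mkcond /=.
apply: eq_bigr => j _; rewrite ffunE -pE mul_polyC.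
by case: ltnP => // le_pj; rewrite nth_default ?scale0r.
Qed.

Lemma finite_powers_unity_root (F : fieldType) (R : seq F) (z : F) :
  z != 0 -> (forall k, z ^+ k \in R) -> exists2 m, (0 < m)%N & z ^+ m = 1.
Proof.
move=> z_neq0 Rz; pose s := mkseq (fun k => z ^+ k) (size R).+1.
have /uniqPn-/(_ 0)[k [l [lt_kl]]] : ~~ uniq s.
  apply/negP=> /uniq_leq_size-/(_ R); rewrite size_mkseq ltnn.
  by case/(_ _)/notF=> x /mapP[k _ ->].
rewrite size_mkseq => lt_l; rewrite !nth_mkseq // ?(ltn_trans lt_kl) //.
move=> eq_kl; exists (l - k)%N; first by rewrite subn_gt0.
by apply: (mulfI (expf_neq0 k z_neq0)); rewrite -exprD subnKC 1?ltnW ?mulr1.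
Qed.

Section Eigenvalues.
Variables (n : nat) (phi : 'M[int]_n).

Lemma coxeter_poly_split :
  map_poly intr (coxeter_poly phi) = \prod_(z <- eigenvalues phi) ('X - z%:P)
    :> {poly algC}.
Proof.
rewrite /eigenvalues; case: closed_field_poly_normal => r /= {1}->.
by rewrite (monicP _) ?scale1r // monic_map ?char_poly_monic.
Qed.

Lemma mem_eigenvalues z :
  (z \in eigenvalues phi) = root (map_poly intr (coxeter_poly phi)) z.
Proof. by rewrite coxeter_poly_split root_prod_XsubC. Qed.

Lemma size_eigenvalues : size (eigenvalues phi) = n.
Proof.
apply/succn_inj; rewrite -(size_prod_XsubC _ id) -coxeter_poly_split.
by rewrite size_map_inj_poly ?size_char_poly //; apply: intr_inj.
Qed.

(** Both sides are the absolute value of the characteristic polynomial at 0. *)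
Lemma prod_norm_eigenvalues :
  \prod_(z <- eigenvalues phi) `|z| = `|(\det phi)%:~R| :> algC.
Proof.
have := congr1 (fun p : {poly algC} => `|p.[0]|) coxeter_poly_split.
rewrite /coxeter_poly horner_coef0 coef_map /= char_poly_det rmorphM rmorphXn /=.
rewrite rmorphN1 normrM normrX normrN1 expr1n mul1r => ->.
rewrite horner_prod normr_prod; apply: eq_bigr => z _.
by rewrite hornerXsubC sub0r normrN.
Qed.

Hypothesis det_phi : \det phi != 0.

Lemma prod_norm_eigenvalues_ge1 : 1 <= \prod_(z <- eigenvalues phi) `|z|.
Proof.
by rewrite prod_norm_eigenvalues norm_intr_ge1 ?intr_int ?intr_eq0.
Qed.

(** The powers of [z] are roots of the characteristic polynomials of the powers
    of [phi].  These are integral of degree [n], and their coefficients are at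
    most [2 ^ n] because all their roots lie in the unit disc; so the powers of
    [z] lie in a finite set. *)
Lemma eigenvalue_unity_root :
    (forall z, z \in eigenvalues phi -> `|z| <= 1) ->
  forall z, z \in eigenvalues phi -> exists2 m, (0 < m)%N & z ^+ m = 1.
Proof.
move=> le1 z phi_z.
have [t tE] := char_poly_exp (map_mx intr phi : 'M[algC]_n).
have tP k : map_poly intr (char_poly (phi ^+ k))
            = \prod_(w <- codom t) ('X - (w ^+ k)%:P) :> {poly algC}.
  by rewrite map_char_poly rmorphXn /= tE big_map big_enum.
have eigE : eigenvalues phi =i codom t.
  move=> w; rewrite mem_eigenvalues /coxeter_poly -[phi]expr1 tP.
  by under eq_bigr do rewrite expr1; rewrite root_prod_XsubC.
have [R memR] := bounded_int_poly_roots n.+1 (2 ^ n)%N.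
apply: (@finite_powers_unity_root _ R) => [|k].
  apply: contraTneq prod_norm_eigenvalues_ge1 => z0.
  by rewrite (big_rem z phi_z) /= z0 normr0 mul0r ler10.
apply: (memR (char_poly (phi ^+ k))).
- by rewrite monic_neq0 ?char_poly_monic.
- by rewrite size_char_poly.
- move=> j; rewrite -(ler_int algC) intr_norm -coef_map /= tP.
  rewrite -(big_map (fun w => w ^+ k) xpredT (fun w => 'X - w%:P)).
  have sz_s : size (map (fun w => w ^+ k) (codom t)) = n.
    by rewrite size_map size_codom card_ord.
  rewrite -pmulrn; set s := map _ _ in sz_s *.
  suff : `|(\prod_(w <- s) ('X - w%:P))`_j| <= (2 ^ size s)%:R by rewrite sz_s.
  apply: coef_prod_XsubC_bound => _ /mapP[w tw ->].
  by rewrite normrX exprn_ile1 // le1 ?eigE.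
rewrite tP -(big_map (fun w => w ^+ k) xpredT (fun w => 'X - w%:P)).
by rewrite root_prod_XsubC; apply/mapP; exists z; rewrite -?eigE.
Qed.
End Eigenvalues.

(** * Cyclotomic factorization *)

(** Euclidean division by a monic polynomial is possible over the integers, and
    its remainder is also the remainder over the complex numbers. *)
Lemma monic_dvd_int (d p : {poly int}) :
    d \is monic ->
    (map_poly intr d : {poly algC}) %| map_poly intr p ->
  exists q : {poly int}, p = q * d.
Proof.
move=> mon_d dv_dp; have pE := Pdiv.RingMonic.rdivp_eq mon_d p.
exists (Pdiv.Ring.rdivp p d); rewrite {1}pE.
suff ->: Pdiv.Ring.rmodp p d = 0 by rewrite addr0.
have inj_intr : injective (intr : int -> algC) by exact: intr_inj.
apply: (map_inj_poly inj_intr) => //; rewrite rmorph0; apply/eqP.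
rewrite pE rmorphD rmorphM /= in dv_dp.
rewrite dvdp_addr ?dvdp_mull // in dv_dp.
apply: contraTT dv_dp => nz_r; rewrite gtNdvdp //.
by rewrite !size_map_inj_poly // Pdiv.Ring.ltn_rmodp monic_neq0.
Qed.

(** A root of [p] of order [m] has ['Phi_m] as minimal polynomial, so that
    ['Phi_m] divides [p], and the quotient again satisfies the hypotheses. *)
Lemma unity_roots_cyclotomic_product (p : {poly int}) :
    p \is monic ->
    (forall z : algC, root (map_poly intr p) z ->
       exists2 m, (0 < m)%N & z ^+ m = 1) ->
  cyclotomic_product p.
Proof.
have [d] := ubnP (size p); elim: d p => // d IHd p /ltnSE le_pd mon_p unity.
have inj_intr : injective (intr : int -> algC) by exact: intr_inj.
have [sz_p | sz_p] := eqVneq (size p) 1.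
  exists [::] => //; rewrite big_nil; move: mon_p.
  by rewrite (size1_polyC (eq_leq sz_p)) monicE lead_coefC => /eqP->.
have [z pz] : exists z : algC, root (map_poly intr p) z.
  by apply/closed_rootP; rewrite size_map_inj_poly.
have [m m_gt0 zm1] := unity z pz.
have [m0 prim_z dv_m0] := prim_order_exists m_gt0 zm1.
have m0_gt0 := prim_order_gt0 prim_z.
have mon_Phi := Cyclotomic_monic m0.
have [q pE] : exists q, p = q * 'Phi_m0.
  apply: monic_dvd_int => //; rewrite (Cintr_Cyclotomic prim_z).
  rewrite -(minCpoly_cyclotomic prim_z).
  have [pz' [-> mon_pz'] dv_pz'] := minCpolyP z.
  have ratE : map_poly intr p = map_poly ratr (map_poly intr p : {poly rat}) :> {poly algC}.
    by rewrite -map_poly_comp; apply: eq_map_poly => b; rewrite /= ratr_int.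
  by rewrite ratE dvdp_map -dv_pz' -ratE.
have mon_q : q \is monic by rewrite -(monicMr q mon_Phi) -pE.
have [||s all_s qE] := IHd q _ mon_q.
- apply: leq_trans le_pd; rewrite pE size_monicM ?monic_neq0 // size_Cyclotomic.
  rewrite addnS /= -[X in (X < _)%N]addn0 ltn_add2l totient_gt0 //.
- by move=> w qw; apply: unity; rewrite pE rmorphM /= rootM qw.
by exists (m0 :: s); rewrite /= ?m0_gt0 // big_cons mulrC -qE.
Qed.

Lemma cyclotomic_product_root_norm (p : {poly int}) (z : algC) :
  cyclotomic_product p -> root (map_poly intr p) z -> `|z| = 1.
Proof.
case=> s /allP s_gt0 ->; rewrite rmorph_prod /=.
rewrite /root horner_prod prodf_seq_eq0 => /hasP[m /s_gt0 m_gt0 /=].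
have [w prim_w] := C_prim_root_exists m_gt0.
rewrite (Cintr_Cyclotomic prim_w) -/(root _ z) root_cyclotomic // => prim_z.
apply/eqP; rewrite -(pexpr_eq1 m_gt0) ?normr_ge0 // -normrX.
by rewrite prim_expr_order ?normr1.
Qed.

(** * Moduli of the eigenvalues *)

(** Each factor of a product of factors at most 1 is at least the product. *)
Lemma prod_norm_ge1_eq1 (s : seq algC) :
    1 <= \prod_(z <- s) `|z| -> (forall z, z \in s -> `|z| <= 1) ->
  forall z, z \in s -> `|z| = 1.
Proof.
move=> prod_ge1 le1 z sz; apply/le_anti; rewrite le1 //=.
apply: le_trans prod_ge1 _; rewrite (big_rem z) //= -[leRHS]mulr1.
rewrite ler_wpM2l // big_seq prodr_ile1 // => w /mem_rem sw.
by rewrite normr_ge0 le1.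
Qed.

(** The order on [algC] is partial, so that the maximum is only controlled
    because norms are comparable. *)
Lemma bigmax_normP (s : seq algC) (b := \big[Num.max/0]_(z <- s) `|z|) :
  0 <= b /\ forall z, z \in s -> `|z| <= b.
Proof.
rewrite {}/b; elim: s => [|a s [b_ge0 IHs]]; first by rewrite big_nil.
rewrite big_cons; set b := \big[_/_]_(_ <- _) _ in b_ge0 IHs *.
have cmp : `|a| >=< b by rewrite real_comparable ?ger0_real.
split=> [|z]; first by rewrite comparable_le_max ?normr_ge0.
rewrite inE comparable_le_max // => /predU1P[-> | /IHs ->]; first by rewrite lexx.
by rewrite orbT.
Qed.

Lemma bigmax_norm_eq1 (s : seq algC) :
    s != [::] -> (forall z, z \in s -> `|z| = 1) ->
  \big[Num.max/0]_(z <- s) `|z| = 1.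
Proof.
case: s => // a s _ eq1; rewrite big_cons eq1 ?mem_head //.
suff /le_gtF b_le1: \big[Num.max/0]_(z <- s) `|z| <= 1 by rewrite /Num.max b_le1.
rewrite big_seq.
apply: (big_ind (fun x : algC => x <= 1)) => [|x y x1 y1|z sz]; first exact: ler01.
  by rewrite /Num.max; case: ifP.
by rewrite eq1 // inE sz orbT.
Qed.

(** All the other factors are at least 1. *)
Lemma prod_max1_norm_ge (s : seq algC) z :
  z \in s -> `|z| <= \prod_(w <- s) Num.max 1 `|w|.
Proof.
have cmp (w : algC) : 1 >=< `|w| by rewrite real_comparable ?ger0_real ?ler01.
have max_ge1 (w : algC) : 1 <= Num.max 1 `|w| by rewrite comparable_le_max // lexx.
move=> sz; rewrite (big_rem z) //= -[leLHS]mulr1.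
apply: ler_pM => //; first by rewrite comparable_le_max // lexx orbT.
by apply: (big_ind (fun x : algC => 1 <= x)) => [|x y|w _] //; first exact: mulr_ege1.
Qed.

(** The geometric mean of the norms is at least 1, which is their arithmetic
    mean; so the two means agree and all the norms are equal. *)
Lemma sum_norm_eq_size (s : seq algC) :
    1 <= \prod_(z <- s) `|z| -> \sum_(z <- s) `|z| = (size s)%:R ->
  forall z, z \in s -> `|z| = 1.
Proof.
move=> prod_ge1 sum_s z sz.
have s_gt0 : (0 < size s)%N by case: s sz {prod_ge1 sum_s}.
pose E (i : 'I_(size s)) := `|s`_i|.
have prodE : \prod_(i in 'I_(size s)) E i = \prod_(z <- s) `|z|.
  by rewrite (big_nth 0) big_mkord.
have sumE : \sum_(i in 'I_(size s)) E i = \sum_(z <- s) `|z|.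
  by rewrite (big_nth 0) big_mkord.
have E_ge0 : {in 'I_(size s), forall i, 0 <= E i} by move=> i _; apply: normr_ge0.
have [] := leif_AGM E_ge0; rewrite prodE sumE sum_s card_ord.
rewrite divff ?pnatr_eq0 -?lt0n // expr1n => prod_le1.
rewrite eq_le prod_le1 prod_ge1 => /esym/forall_inP constE.
pose i := Ordinal (etrans (index_mem z s) sz).
have Ei : E i = `|z| by rewrite /E nth_index.
have sumEi : \sum_(j in 'I_(size s)) E j = (size s)%:R * `|z|.
  rewrite (eq_bigr (fun=> `|z|)) => [|j _]; last first.
    by rewrite -Ei; apply/esym/eqP; have /forall_inP := constE i isT; apply.
  by rewrite sumr_const card_ord mulr_natl.
apply: (mulfI (_ : (size s)%:R != 0)); first by rewrite pnatr_eq0 -lt0n.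
by rewrite mulr1 -sumEi sumE.
Qed.

Theorem theorem1 (k : closedFieldType) (A : falgType k) (n : nat)
    (S : 'I_n -> fdmod A) (cl : fdmod A -> 'cV[int]_n) (phi : 'M[int]_n)
    (A_triangular : triangular_algebra A)
    (S_simples : simple_enumeration S)
    (cl_K0 : grothendieck_class cl)
    (phi_coxeter : coxeter_transformation S cl phi) :
  [<-> (* 1 *) forall z, z \in eigenvalues phi -> `|z| <= 1;
       (* 2 *) forall z, z \in eigenvalues phi -> `|z| = 1;
       (* 3 *) spectral_radius phi = 1;
       (* 4 *) mahler_measure phi = 1;
       (* 5 *) energy phi = n%:R;
       (* 6 *) cyclotomic_product (coxeter_poly phi)].
Proof.
have [_ _ acyclic] := A_triangular.
have det_phi := coxeter_det_neq0 acyclic S_simples cl_K0 phi_coxeter.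
have prod_ge1 := prod_norm_eigenvalues_ge1 det_phi.
have le1_eq1 := prod_norm_ge1_eq1 prod_ge1.
have n_gt0 := simple_enumeration_nonempty S_simples.
tfae.
- exact: le1_eq1.
- apply: bigmax_norm_eq1.
  by rewrite -size_eq0 size_eigenvalues -lt0n.
- move=> radius1; have [_ le_radius] := bigmax_normP (eigenvalues phi).
  rewrite -/(spectral_radius phi) radius1 in le_radius.
  rewrite /mahler_measure big_seq big1 // => z phi_z.
  by rewrite (le1_eq1 le_radius) // maxxx.
- move=> mahler1.
  have le1 z : z \in eigenvalues phi -> `|z| <= 1.
    by move=> /prod_max1_norm_ge; rewrite -/(mahler_measure phi) mahler1.
  rewrite /energy big_seq (eq_bigr _ (le1_eq1 le1)) -big_seq.
  by rewrite big_const_seq count_predT size_eigenvalues iter_addr_0.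
- move=> energy_n; have eq1 : forall z, z \in eigenvalues phi -> `|z| = 1.
    by apply: sum_norm_eq_size prod_ge1 _; rewrite size_eigenvalues.
  apply: unity_roots_cyclotomic_product => [|z]; first exact: char_poly_monic.
  rewrite -mem_eigenvalues; apply: eigenvalue_unity_root => // w /eq1->.
  exact: lexx.
- move=> cyclo z; rewrite mem_eigenvalues => /(cyclotomic_product_root_norm cyclo)->.
  exact: lexx.
Qed.
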